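(* Let $m\le n$, let $\mathbf{F}=[\mathbf{f}_1,\dots,\mathbf{f}_n]\in\mathbb{R}^{m\times n}$ have nonzero columns, let $\boldsymbol{y}\in\mathbb{R}^m$ and $\sigma>0$. For $\boldsymbol{\gamma}\in\mathbb{R}^n_+$ put $\mathsf{S}(\boldsymbol{\gamma})=\sigma^{-1}\mathbf{I}_m+\mathbf{F}\,\mathrm{diag}(\boldsymbol{\gamma})\,\mathbf{F}^\top$ and $$\mathcal{J}(\boldsymbol{\gamma})=\frac12\boldsymbol{y}^\top\mathsf{S}(\boldsymbol{\gamma})^{-1}\boldsymbol{y}+\frac12\log\det\mathsf{S}(\boldsymbol{\gamma})+\sum_{i=1}^n\mathcal{H}(\gamma_i),$$ where $\mathcal{H}$ is a continuous function on $[0,+\infty)$, differentiable on $(0,+\infty)$. Let $\tau>0$, let $\mathcal{H}$ be nonnegative and either convex or concave, and let $\{(\boldsymbol{x}^{(k)},\boldsymbol{\gamma}^{(k)})\}$ be generated by the PALM algorithm (given in the context, with threshold parameter $\omega$) with an initial positive $\boldsymbol{\gamma}^{(0)}$, i.e. all entries of $\boldsymbol{\gamma}^{(0)}$ are positive. Then the following convergence results hold: (I) The sequence $\{\mathcal{J}(\boldsymbol{\gamma}^{(k)})\}$ is strictly decreasing and convergent. (II) There exists a subsequence of indices $\{s_k\}\subset\mathbb{N}$ such that $\{\boldsymbol{x}^{(s_k)}\}$ and $\{\boldsymbol{\gamma}^{(s_k)}\}$ converge. (III) The limit $\boldsymbol{\gamma}^\star$ of $\{\boldsymbol{\gamma}^{(s_k)}\}$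 is a KKT point of $\min_{\boldsymbol{\gamma}\in\mathbb{R}^n_+}\mathcal{J}(\boldsymbol{\gamma})$, that is, for each $1\le i\le n$, either $\gamma_i^\star=0$ or $\frac{\partial\mathcal{J}(\boldsymbol{\gamma}^\star)}{\partial\gamma_i}=0$ holds.
   Context: $\mathbb{R}^n_+=\{\boldsymbol{\gamma}\in\mathbb{R}^n:\gamma_i\ge0,\ 1\le i\le n\}$. PALM algorithm. Inputs: $\boldsymbol{y}$, $\mathbf{F}$, $\sigma$, the proximal parameter $\tau$, and a threshold $\omega$ (below which entries of $\boldsymbol{\gamma}$ are set to zero). Initialize $\boldsymbol{\gamma}^{(0)}$; for $k=0,1,2,\dots$ (as long as $\boldsymbol{x}^{(k)}$ has not converged) do: 1. $\boldsymbol{x}$-update: $\boldsymbol{x}^{(k+1)}=\mathrm{diag}(\boldsymbol{\gamma}^{(k)})\,\mathbf{F}^\top\mathsf{S}(\boldsymbol{\gamma}^{(k)})^{-1}\boldsymbol{y}$. 2. $\boldsymbol{\gamma}$-update: for each $i=1,\dots,n$, if $\gamma_i^{(k)}=0$, set $\gamma_i^{(k+1)}=0$; otherwise set $$\gamma_i^{(k+1)}=\arg\min_{\gamma_i>0}\ \frac{\big(x_i^{(k+1)}\big)^2}{2\gamma_i}+\ell_i^{(k)}(\gamma_i)+\frac{\tau}{2}\big(\gamma_i-\gamma_i^{(k)}\big)^2,$$ and then, if this $\gamma_i^{(k+1)}<\omega$, set $\gamma_i^{(k+1)}=0$. Here, with $\tilde q_{ii}^{(k)}=\mathbf{f}_i^\top\mathsf{S}(\boldsymbol{\gamma}^{(k)})^{-1}\mathbf{f}_i$,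 up to additive constants not depending on $\gamma_i$, $$\ell_i^{(k)}(\gamma_i)=\begin{cases}\frac12\tilde q_{ii}^{(k)}\gamma_i+\mathcal{H}(\gamma_i), & \text{if }\mathcal{H}\text{ is convex},\\[2pt] \left(\frac12\tilde q_{ii}^{(k)}+\mathcal{H}'(\gamma_i^{(k)})\right)\gamma_i, & \text{if }\mathcal{H}\text{ is nonconvex}.\end{cases}$$
   Formalization: Strict decrease in (I) is asserted only for steps where no nonzero entry is set to zero by the threshold ω (thresholding can raise J); ''as long as x has not converged'' is read as: consecutive computed x-iterates always differ. *)

(* Defs.v *)
From HB Require Import structures.
From mathcomp Require Import all_boot all_order all_algebra.
From mathcomp Require Import all_classical all_reals all_analysis.

Set Implicit Arguments.
Unset Strict Implicit.
Unset Printing Implicit Defensive.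

Import Order.TTheory GRing.Theory Num.Theory.
Import numFieldNormedType.Exports.

Local Open Scope classical_set_scope.
Local Open Scope ring_scope.

Definition covS (R : realType) (m n : nat) (F : 'M[R]_(m, n)) (sigma : R)
    (gamma : 'cV[R]_n) : 'M[R]_m :=
  (sigma^-1)%:M + F *m diag_mx gamma^T *m F^T.

(* Meaningful for gamma with nonnegative entries, where covS is positive
   definite; elsewhere it takes the default values of invmx, ln and H. *)
Definition objJ (R : realType) (m n : nat) (F : 'M[R]_(m, n)) (y : 'cV[R]_m)
    (sigma : R) (H : R -> R) (gamma : 'cV[R]_n) : R :=
  2^-1 * (y^T *m invmx (covS F sigma gamma) *m y) 0 0
  + 2^-1 * ln (\det (covS F sigma gamma))
  + \sum_(i < n) H (gamma i 0).

Definition convex_on_ray (R : realType) (H : R -> R) : Prop :=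
  convex_function (`[0, +oo[%classic : set R^o) (H : R^o -> R^o).

Definition concave_on_ray (R : realType) (H : R -> R) : Prop :=
  convex_on_ray (fun t => - H t).

Definition qtilde (R : realType) (m n : nat) (F : 'M[R]_(m, n)) (sigma : R)
    (gamma : 'cV[R]_n) (i : 'I_n) : R :=
  ((col i F)^T *m invmx (covS F sigma gamma) *m col i F) 0 0.

Definition ell (R : realType) (m n : nat) (F : 'M[R]_(m, n)) (sigma : R)
    (H : R -> R) (gamma : 'cV[R]_n) (i : 'I_n) (g : R) : R :=
  if `[< convex_on_ray H >]
  then 2^-1 * qtilde F sigma gamma i * g + H g
  else (2^-1 * qtilde F sigma gamma i + derive1 H (gamma i 0)) * g.

Definition prox_obj (R : realType) (m n : nat) (F : 'M[R]_(m, n)) (sigma : R)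
    (H : R -> R) (tau : R) (x gamma : 'cV[R]_n) (i : 'I_n) (g : R) : R :=
  (x i 0) ^+ 2 / (2 * g) + ell F sigma H gamma i g
  + tau / 2 * (g - gamma i 0) ^+ 2.

Definition is_argmin_pos (R : realType) (f : R -> R) (g : R) : Prop :=
  0 < g /\ forall t, 0 < t -> f g <= f t.

(* The entry x 0 is never used: the algorithm only initializes gamma 0. *)
Record palm_sequence (R : realType) (m n : nat) (F : 'M[R]_(m, n))
    (y : 'cV[R]_m) (sigma : R) (H : R -> R) (tau omega : R)
    (x gamma : nat -> 'cV[R]_n) : Prop := {
  palm_x_update : forall k,
    x k.+1 = diag_mx (gamma k)^T *m F^T
             *m invmx (covS F sigma (gamma k)) *m y ;
  palm_gamma_zero : forall k i, gamma k i 0 = 0 -> gamma k.+1 i 0 = 0 ;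
  palm_gamma_update : forall k i, gamma k i 0 <> 0 ->
    exists2 g,
      is_argmin_pos (prox_obj F sigma H tau (x k.+1) (gamma k) i) g &
      gamma k.+1 i 0 = if g < omega then 0 else g ;
  (* The loop runs as long as x has not converged, so an infinite sequence is
     generated only when no computed x-iterate repeats its predecessor. *)
  palm_running : forall k, x k.+2 <> x k.+1
}.

(* Minimizers in the update are positive, so a nonzero entry can only become
   zero by falling below the threshold; this happens at most once per entry,
   hence in at most n iterations. *)
Definition no_entry_thresholded (R : realType) (n : nat)
    (gamma : nat -> 'cV[R]_n) (k : nat) : Prop :=
  forall i, gamma k i 0 <> 0 -> gamma k.+1 i 0 <> 0.

Definition is_KKT (R : realType) (n : nat) (J : 'cV[R]_n -> R)
    (gamma : 'cV[R]_n) : Prop :=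
  (forall i, 0 <= gamma i 0) /\
  forall i, gamma i 0 = 0 \/ is_derive gamma (delta_mx i 0) (J : _ -> R^o) 0.

(* Main.v *)
(* Majorization-minimization. With [u = S(g)^-1 y] and [x = diag(g) F^T u], the
   form [y^T S(g')^-1 y] is at most [|u|^2 / sigma + sum_i x_i^2 / g'_i], with
   equality at [g' = g]; [ln det S] lies below its tangent plane, whose slopes
   are the [qtilde_i]; a concave [H] lies below its tangent lines. Hence one
   unthresholded step gains at least [tau / 2 |g' - g|^2], and [g' <> g] as long
   as [x] keeps moving. An entry that vanishes stays zero, so only finitely many
   steps threshold; [J] is then decreasing and bounded below, the iterates are
   bounded since [det S] grows linearly along each coordinate, and consecutive
   differences tend to 0. Along a convergent subsequence, the stationarity
   equations of the proximal subproblems pass to the limit: only the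
   convergence of [H'] at the iterates needs an argument, and its limit is a
   subgradient (or supergradient) of [H], hence the derivative. *)
Require Import Defs.
From HB Require Import structures.
From mathcomp Require Import all_boot all_order all_algebra.
From mathcomp Require Import all_classical all_reals all_analysis.
From mathcomp Require Import ring lra.

Import Order.TTheory GRing.Theory Num.Theory.
Import numFieldNormedType.Exports.

Local Open Scope classical_set_scope.
Local Open Scope ring_scope.

Set Implicit Arguments.
Unset Strict Implicit.

(** * Positive definite matrices *)

Section PosDef.
Context {R : realType}.

Definition posdef m (A : 'M[R]_m) : Prop :=
  A^T = A /\ forall v : 'cV[R]_m, v != 0 -> 0 < (v^T *m A *m v) 0 0.

Lemma mxE00_dot m (u v : 'cV[R]_m) : (u^T *m v) 0 0 = \sum_i u i 0 * v i 0.
Proof. by rewrite mxE; apply: eq_bigr => i _; rewrite mxE. Qed.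

Lemma dot_ge0 m (u : 'cV[R]_m) : 0 <= (u^T *m u) 0 0.
Proof. by rewrite mxE00_dot; apply: sumr_ge0 => i _; rewrite -expr2 sqr_ge0. Qed.

Lemma dot_gt0 m (u : 'cV[R]_m) : u != 0 -> 0 < (u^T *m u) 0 0.
Proof.
move=> u0; rewrite lt_neqAle dot_ge0 andbT eq_sym mxE00_dot.
apply: contra_neq u0 => /psumr_eq0P u0; apply/matrixP => i j.
rewrite !mxE (ord1 j); apply/eqP; rewrite -sqrf_eq0 expr2; apply/eqP/u0 => //.
by move=> k _; rewrite -expr2 sqr_ge0.
Qed.

Lemma posdef_quad_ge0 m (A : 'M[R]_m) (v : 'cV[R]_m) :
  posdef A -> 0 <= (v^T *m A *m v) 0 0.
Proof.
move=> [_ Apos]; have [->|/Apos/ltW//] := eqVneq v 0.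
by rewrite mulmx0 mxE.
Qed.

(** A nonzero [u] in the left kernel would make the quadratic form vanish at [u^T]. *)
Lemma posdef_unit m (A : 'M[R]_m) : posdef A -> A \in unitmx.
Proof.
move=> [Asym Apos]; rewrite -row_free_unit -kermx_eq0.
apply/negPn/negP => /rowV0Pn[u /sub_kermxP uA u0].
have ut0 : u^T != 0.
  by apply: contra_neq u0 => /(congr1 trmx); rewrite trmxK trmx0.
by have := Apos _ ut0; rewrite trmxK uA mul0mx mxE ltxx.
Qed.

Lemma posdef_congr m (P A : 'M[R]_m) :
  P \in unitmx -> posdef A -> posdef (P *m A *m P^T).
Proof.
move=> Pu [Asym Apos]; split; first by rewrite !trmx_mul trmxK Asym mulmxA.
move=> v v0; have := Apos (P^T *m v); rewrite trmx_mul trmxK !mulmxA; apply.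
apply: contra_neq v0 => Pv; have Ptu : P^T \in unitmx by rewrite unitmx_tr.
by rewrite -(mulKmx Ptu v) Pv mulmx0.
Qed.

Lemma posdef_inv m (A : 'M[R]_m) : posdef A -> posdef (invmx A).
Proof.
move=> Apos; have Au := posdef_unit Apos.
have := @posdef_congr _ (invmx A) A; rewrite unitmx_inv => /(_ Au Apos).
by rewrite mulVmx // mul1mx trmx_inv Apos.1.
Qed.

(** One step of symmetric Gaussian elimination: [E] clears the first row and column, leaving the
    pivot and its Schur complement, the lower block minus [a^-1 b b^T]. The trace can only drop,
    since [b b^T] has trace [|b|^2]. *)
Lemma posdef_schur m (A : 'M[R]_(1 + m)) : posdef A ->
  exists (E : 'M[R]_(1 + m)) (S : 'M[R]_m),
    [/\ \det E = 1, E *m A *m E^T = block_mx (ulsubmx A) 0 0 S,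
        posdef S, 0 < ulsubmx A 0 0 & \tr S <= \tr (drsubmx A)].
Proof.
move=> Apos; have [Asym Aq] := Apos.
pose a := ulsubmx A 0 0; pose b := dlsubmx A.
have Aul : ulsubmx A = a%:M by rewrite [LHS]mx11_scalar.
have Aur : ursubmx A = b^T by rewrite /b -[in LHS]Asym trmx_dlsub.
have a0 : 0 < a.
  have := Aq (col_mx 1 0); rewrite -{1}(submxK A) Aul Aur.
  rewrite tr_col_mx mul_row_block mul_row_col !trmx0 !mulmx0 !mul0mx !addr0.
  rewrite trmx1 mul1mx mulmx1 mxE mulr1n; apply.
  by apply/eqP => /(congr1 usubmx); rewrite col_mxKu linear0 => /eqP; rewrite oner_eq0.
pose E : 'M[R]_(1 + m) := block_mx 1%:M 0 (- a^-1 *: b) 1%:M.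
pose S := drsubmx A - a^-1 *: (b *m b^T).
have detE : \det E = 1 by rewrite det_lblock !det1 mulr1.
have Eu : E \in unitmx by rewrite unitmxE detE unitr1.
have EAE : E *m A *m E^T = block_mx (ulsubmx A) 0 0 S.
  rewrite -{1}(submxK A) Aul Aur -/b tr_block_mx !mulmx_block.
  rewrite !trmx1 !trmx0 !mul1mx !mul0mx !mulmx1 !mulmx0 !addr0.
  have ba : - a^-1 *: b *m a%:M + b = 0.
    by rewrite mul_mx_scalar scalerA mulrN divff ?gt_eqF // scaleN1r addNr.
  rewrite ba mul0mx add0r linearZ /= mul_scalar_mx scalerA mulrN.
  rewrite divff ?gt_eqF // scaleN1r addNr; congr block_mx.
  by rewrite -scalemxAl scaleNr addrC.
exists E, S; split => //; last first.
- rewrite /S raddfB /= linearZ /= mxtrace_mulC [b^T *m b]mx11_scalar.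
  by rewrite mxtrace_scalar mulr1n gerBl mulr_ge0 ?invr_ge0 ?(ltW a0) ?dot_ge0.
- have [Ssym Sq] := posdef_congr Eu Apos; split.
    by move: Ssym; rewrite EAE tr_block_mx => /eq_block_mx[].
  move=> v v0; have := Sq (col_mx 0 v); rewrite EAE tr_col_mx.
  rewrite mul_row_block mul_row_col trmx0 !mul0mx mulmx0 !add0r; apply.
  by apply: contra_neq v0 => /(congr1 dsubmx); rewrite col_mxKd linear0.
Qed.

(** Cholesky-type reduction by induction on the size: eliminate, then scale the pivot to 1 by its
    inverse square root. *)
Lemma posdef_factor m (A : 'M[R]_m) : posdef A ->
  exists P : 'M[R]_m, P *m A *m P^T = 1%:M.
Proof.
elim: m A => [|m IH]; first by exists 0; apply/matrixP => -[].
(* The size is written [1 + m] so that block decompositions apply. *)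
suff: forall A : 'M[R]_(1 + m), posdef A ->
    exists P : 'M[R]_(1 + m), P *m A *m P^T = 1%:M by [].
move=> A Apos; have [E [S [_ EAE Spos a0 _]]] := posdef_schur Apos.
have [Q QSQ] := IH _ Spos.
set a := ulsubmx _ 0 0 in a0; pose c := (Num.sqrt a)^-1.
exists (block_mx c%:M 0 0 Q *m E).
rewrite trmx_mul -!mulmxA (mulmxA A) (mulmxA E) (mulmxA E A) EAE.
rewrite tr_block_mx !mulmx_block !trmx0 !mulmx0 !mul0mx !addr0 !add0r.
rewrite (mulmxA Q S) QSQ [ulsubmx _]mx11_scalar -/a tr_scalar_mx -!scalar_mxM.
rewrite [X in block_mx X%:M](_ : _ = 1) ?mulmx0 -?scalar_mx_block //.
by rewrite mulrCA -expr2 exprVn sqr_sqrtr ?ltW // divff // gt_eqF.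
Qed.

Lemma posdef_det_gt0 m (A : 'M[R]_m) : posdef A -> 0 < \det A.
Proof.
move=> /posdef_factor[P /(congr1 determinant)].
rewrite !det_mulmx det_tr det1 => PA1.
have P0 : \det P != 0 by apply: contra_eq_neq PA1 => ->; rewrite !mul0r eq_sym oner_eq0.
have -> : \det A = (\det P ^+ 2)^-1.
  by apply: (mulIf P0); apply: (mulfI P0); rewrite mulrA PA1; field.
by rewrite invr_gt0 exprn_even_gt0.
Qed.

(* Hadamard's inequality and [c <= exp (c - 1)], merged in one induction. *)
Lemma posdef_det_le m (A : 'M[R]_m) : posdef A ->
  \det A <= expR (\tr A - m%:R).
Proof.
elim: m A => [|m IH].
  by move=> A _; rewrite det_mx00 /mxtrace big_ord0 subrr expR0.
suff: forall A : 'M[R]_(1 + m), posdef A ->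
    \det A <= expR (\tr A - m.+1%:R) by [].
move=> A Apos.
have [E [S [dE EAE Spos a0 trS]]] := posdef_schur Apos.
set a := ulsubmx _ 0 0 in a0; set B := drsubmx _ in trS.
have -> : \det A = a * \det S.
  have := congr1 determinant EAE.
  by rewrite !det_mulmx det_tr dE mul1r mulr1 det_lblock det_mx11.
have -> : \tr A = a + \tr B.
  by rewrite -{1}(submxK A) mxtrace_block /mxtrace big_ord1.
rewrite -natr1 (_ : _ - _ = (a - 1) + (\tr B - m%:R)); last by ring.
rewrite expRD; apply: ler_pM.
- exact: ltW.
- exact/ltW/posdef_det_gt0.
- by apply: le_trans (expR_ge1Dx _); rewrite addrC subrK.
- by apply: le_trans (IH _ Spos) _; rewrite ler_expR lerD2r.
Qed.

(** Concavity of [ln det], as a tangent plane at [A]. The congruence [P] taking [A] to the identity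
    reduces it to [posdef_det_le] for [P B P^T], whose trace is that of [A^-1 B]. *)
Lemma posdef_ln_det_le m (A B : 'M[R]_m) : posdef A -> posdef B ->
  ln (\det B) <= ln (\det A) + \tr (invmx A *m (B - A)).
Proof.
move=> Apos Bpos; have [P PAP] := posdef_factor Apos.
have Au := posdef_unit Apos.
have Pu : P \in unitmx by move: PAP; rewrite -mulmxA => /mulmx1_unit[].
have PtP : P^T *m P = invmx A.
  by rewrite -[RHS]mul1mx -(mulmx1C PAP) mulmxA mulmxK.
have dA : \det A = (\det P)^-1 * (\det P)^-1.
  have := congr1 determinant PAP; rewrite !det_mulmx det_tr det1.
  move: Pu; rewrite unitmxE unitfE => P0 PA1.
  by apply: (mulIf P0); apply: (mulfI P0); rewrite mulrA PA1; field.
have := posdef_det_le (posdef_congr Pu Bpos).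
rewrite mxtrace_mulC mulmxA PtP mulmxBr mulVmx // raddfB /= mxtrace1.
set T := \tr _ - _ => le_det; rewrite -lerBlDl -ler_expR.
rewrite -ln_div ?posrE ?posdef_det_gt0 // lnK ?posrE; last first.
  by rewrite divr_gt0 ?posdef_det_gt0.
apply: le_trans le_det; rewrite !det_mulmx det_tr dA.
by rewrite le_eqVlt; apply/orP; left; apply/eqP; rewrite invfM !invrK; ring.
Qed.
End PosDef.

(** * The covariance matrix *)

Section Covariance.
Context {R : realType} {m n : nat} (F : 'M[R]_(m, n)) (sigma : R).
Hypothesis sigma_gt0 : 0 < sigma.

Local Notation S := (covS F sigma).

Lemma trmulmx_col (v : 'cV[R]_m) i : ((col i F)^T *m v) 0 0 = (F^T *m v) i 0.
Proof. by rewrite mxE00_dot mxE; apply: eq_bigr => k _; rewrite !mxE. Qed.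

Lemma covS_bilinear (u v : 'cV[R]_m) (g : 'cV[R]_n) :
  (u^T *m S g *m v) 0 0 = sigma^-1 * (u^T *m v) 0 0
    + \sum_i g i 0 * (F^T *m u) i 0 * (F^T *m v) i 0.
Proof.
rewrite /covS mulmxDr mulmxDl mxE; congr (_ + _).
  by rewrite mul_mx_scalar -scalemxAl mxE.
rewrite !mulmxA -[u^T *m F]trmxK trmx_mul trmxK -!mulmxA mul_diag_mx mxE00_dot.
by apply: eq_bigr => i _; rewrite !mxE; ring.
Qed.

Lemma covS_tr (g : 'cV[R]_n) : (S g)^T = S g.
Proof.
by rewrite /covS linearD /= tr_scalar_mx !trmx_mul trmxK tr_diag_mx mulmxA.
Qed.

Lemma covS_posdef (g : 'cV[R]_n) : (forall i, 0 <= g i 0) -> posdef (S g).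
Proof.
move=> g0; split => [|v v0]; first exact: covS_tr.
rewrite covS_bilinear ltr_pwDl //.
  by rewrite mulr_gt0 ?invr_gt0 ?dot_gt0.
by apply: sumr_ge0 => i _; rewrite -mulrA mulr_ge0 // -expr2 sqr_ge0.
Qed.

Lemma qtildeE (g : 'cV[R]_n) i :
  qtilde F sigma g i = (F^T *m invmx (S g) *m F) i i.
Proof.
rewrite /qtilde tr_col -row_mul mxE [RHS]mxE.
by apply: eq_bigr => k _; rewrite [X in X * _]mxE [X in _ * X]mxE.
Qed.

Lemma qtilde_ge0 (g : 'cV[R]_n) i :
  (forall i, 0 <= g i 0) -> 0 <= qtilde F sigma g i.
Proof. by move=> g0; apply/posdef_quad_ge0/posdef_inv/covS_posdef. Qed.

(** The tangent plane of [ln det] at [S g]; cycling the trace of [S(g)^-1 F diag(g' - g) F^T] brings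
    out the diagonal of [F^T S(g)^-1 F]. *)
Lemma ln_det_covS_le (g g' : 'cV[R]_n) :
  (forall i, 0 <= g i 0) -> (forall i, 0 <= g' i 0) ->
  ln (\det (S g')) <= ln (\det (S g))
    + \sum_i qtilde F sigma g i * (g' i 0 - g i 0).
Proof.
move=> g0 g'0; apply: le_trans (posdef_ln_det_le _ _) _; first exact: covS_posdef g0.
  exact: covS_posdef.
rewrite lerD2l le_eqVlt; apply/orP; left; apply/eqP.
have -> : S g' - S g = F *m diag_mx (g' - g)^T *m F^T.
  rewrite /covS opprD addrACA subrr add0r !linearB /=.
  by rewrite mulmxBl.
rewrite !mulmxA mxtrace_mulC !mulmxA mxtrace_mulC mul_diag_mx /mxtrace.
by apply: eq_bigr => i _; rewrite qtildeE !mxE mulrC.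
Qed.

(** The tangent plane taken at the larger point [g'] has nonnegative slopes. *)
Lemma ln_det_covS_homo (g g' : 'cV[R]_n) :
  (forall i, 0 <= g i 0) -> (forall i, g i 0 <= g' i 0) ->
  ln (\det (S g)) <= ln (\det (S g')).
Proof.
move=> g0 gg'; have g'0 i : 0 <= g' i 0 by apply: le_trans (gg' i).
apply: le_trans (ln_det_covS_le g'0 g0) _; rewrite gerDl.
by apply: sumr_le0 => i _; rewrite mulr_ge0_le0 ?qtilde_ge0 // subr_le0.
Qed.

Lemma covS_shift (g : 'cV[R]_n) i h :
  S (g + h *: delta_mx i 0) = S g + h *: (col i F *m (col i F)^T).
Proof.
rewrite /covS linearD /= linearD /= mulmxDr mulmxDl addrA; congr (_ + _).
apply/matrixP => j k; rewrite -mulmxA mul_diag_mx !mxE big_ord1 !mxE.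
rewrite (bigD1 i) //= big1 ?addr0 => [|l li]; rewrite !mxE ?eqxx //=.
  by rewrite mulr1; ring.
by rewrite (negPf li) mulr0 mul0r mulr0.
Qed.

(* Both [u := (S g)^-1 y] and [u' := (S g')^-1 y] recover [y^T u'] from the
   bilinear form, so that [y^T u' = 2 u^T (S g) u' - u'^T (S g') u']; complete
   the squares in [u'] and in each coordinate of [F^T u']. *)
Lemma quad_inv_covS_le (y : 'cV[R]_m) (g g' x : 'cV[R]_n) :
  (forall i, 0 <= g i 0) -> (forall i, 0 <= g' i 0) ->
  (forall i, g i 0 = 0 -> g' i 0 = 0) -> (forall i, g i 0 != 0 -> g' i 0 != 0) ->
  x = diag_mx g^T *m F^T *m invmx (S g) *m y ->
  (y^T *m invmx (S g') *m y) 0 0 - (y^T *m invmx (S g) *m y) 0 0 <=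
  \sum_i (x i 0 ^+ 2 / g' i 0 - x i 0 ^+ 2 / g i 0).
Proof.
move=> g0 g'0 gz gnz xE.
have Su := posdef_unit (covS_posdef g0); have Su' := posdef_unit (covS_posdef g'0).
pose u := invmx (S g) *m y; pose u' := invmx (S g') *m y.
have yu : y = S g *m u by rewrite /u mulKVmx.
have yu' : y = S g' *m u' by rewrite /u' mulKVmx.
have xi i : x i 0 = g i 0 * (F^T *m u) i 0.
  by rewrite xE -!mulmxA mul_diag_mx !mxE.
have E1 : (y^T *m invmx (S g) *m y) 0 0 = (u^T *m S g *m u) 0 0.
  by rewrite -mulmxA -/u {1}yu trmx_mul covS_tr.
have E2 : (y^T *m invmx (S g') *m y) 0 0 = (u^T *m S g *m u') 0 0.
  by rewrite -mulmxA -/u' {1}yu trmx_mul covS_tr.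
have E3 : (y^T *m invmx (S g') *m y) 0 0 = (u'^T *m S g' *m u') 0 0.
  by rewrite -mulmxA -/u' {1}yu' trmx_mul covS_tr.
have -> : (y^T *m invmx (S g') *m y) 0 0 =
    2 * (u^T *m S g *m u') 0 0 - (u'^T *m S g' *m u') 0 0.
  by rewrite -E2 -E3; ring.
rewrite E1 !covS_bilinear.
have dot_le : 2 * (u^T *m u') 0 0 - (u'^T *m u') 0 0 <= (u^T *m u) 0 0.
  rewrite -subr_ge0; have := dot_ge0 (u - u').
  rewrite !mxE00_dot mulr_sumr -!sumrB => /le_trans; apply.
  rewrite le_eqVlt; apply/orP; left; apply/eqP; apply: eq_bigr => i _.
  by rewrite !mxE; ring.
set A := (u^T *m u') 0 0 in dot_le *; set B := (u'^T *m u') 0 0 in dot_le *.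
set C := (u^T *m u) 0 0 in dot_le *.
set T1 := \sum_i _; set T2 := \sum_i _; set T3 := \sum_i _; set T4 := \sum_i _.
have : 2 * T1 - T2 - T3 <= T4.
  rewrite /T1 mulr_sumr -!sumrB; apply: ler_sum => i _; rewrite xi.
  (* Where [g i 0] vanishes, so do [g' i 0] and [x i 0]; the quotients by zero then have numerator
     zero. *)
  have [gi0|gi0] := eqVneq (g i 0) 0.
    by rewrite gi0 gz // !(mul0r, mulr0, expr0n, subrr).
  have gi'0 := gnz _ gi0; set a := (_ *m u) i 0; set b := (_ *m u') i 0.
  rewrite -subr_ge0 (_ : _ - _ = (g i 0 * a - g' i 0 * b) ^+ 2 / g' i 0).
    by rewrite divr_ge0 ?sqr_ge0.
  by field; rewrite gi0 gi'0.
have : sigma^-1 * (2 * A - B) <= sigma^-1 * C by rewrite ler_pM2l ?invr_gt0.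
by lra.
Qed.

End Covariance.

(** * Rank-one updates *)

Section RankOne.
Context {R : realType} {m : nat}.
Implicit Types (A : 'M[R]_m) (f y : 'cV[R]_m).

(** Matrix determinant lemma: [M E] and [E M] have the same determinant and are both block lower
    triangular, one showing each side. *)
Lemma det_add1_rank1 (u v : 'cV[R]_m) :
  \det (1%:M + u *m v^T) = 1 + (v^T *m u) 0 0.
Proof.
pose M : 'M[R]_(1 + m) := block_mx 1%:M (- v^T) u 1%:M.
pose E : 'M[R]_(1 + m) := block_mx 1%:M v^T 0 1%:M.
have -> : \det (1%:M + u *m v^T) = \det (M *m E).
  rewrite mulmx_block !mulmx1 !mul1mx !mulmx0 !addr0 subrr.
  by rewrite det_lblock det1 mul1r addrC.
have -> : \det (M *m E) = \det (E *m M) by rewrite !det_mulmx mulrC.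
rewrite mulmx_block !mulmx1 !mul1mx !mul0mx !add0r addNr det_lblock det1 mulr1.
by rewrite det_mx11 !mxE eqxx.
Qed.

Lemma det_rank1_update A f h : A \in unitmx ->
  \det (A + h *: (f *m f^T)) =
    \det A * (1 + h * (f^T *m invmx A *m f) 0 0).
Proof.
move=> Au; have -> : A + h *: (f *m f^T) = A *m (1%:M + (h *: invmx A *m f) *m f^T).
  by rewrite mulmxDr mulmx1 -!scalemxAl -scalemxAr mulmxA mulmxA mulmxV // mul1mx.
rewrite det_mulmx det_add1_rank1; congr (_ * (1 + _)).
by rewrite -!scalemxAl -scalemxAr mxE mulmxA.
Qed.

(** Sherman-Morrison formula, tested against [y] on both sides. *)
Lemma quad_inv_rank1_update A f y h : A^T = A -> A \in unitmx ->
  let q := (f^T *m invmx A *m f) 0 0 in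
  1 + h * q != 0 ->
  (y^T *m invmx (A + h *: (f *m f^T)) *m y) 0 0 =
  (y^T *m invmx A *m y) 0 0
    - h * ((f^T *m invmx A *m y) 0 0) ^+ 2 / (1 + h * q).
Proof.
move=> Asym Au q q0; set B := A + _.
have Bu : B \in unitmx.
  by rewrite unitmxE det_rank1_update // unitrM -unitmxE Au unitfE.
pose s := (f^T *m invmx A *m y) 0 0.
(* The candidate for [B^-1 y], verified by multiplying back by [B]. *)
pose w := invmx A *m y - (h * s / (1 + h * q)) *: (invmx A *m f).
have Bw : B *m w = y.
  have fw : f^T *m w = (s / (1 + h * q))%:M.
    rewrite [LHS]mx11_scalar; congr _%:M.
    rewrite /w mulmxBr -scalemxAr !mulmxA !mxE -/s -/q.
    have -> : \sum_j (f^T *m invmx A) 0 j * y j 0 = s by rewrite /s mxE.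
    have -> : \sum_j (f^T *m invmx A) 0 j * f j 0 = q by rewrite /q mxE.
    by field.
  rewrite /B mulmxDl -scalemxAl -mulmxA fw mul_mx_scalar /w mulmxBr -scalemxAr.
  by rewrite !mulKVmx // scalerA mulrA subrK.
rewrite -(mulmxA _ _ y) -{2}Bw mulKmx // /w mulmxBr -scalemxAr mulmxA mxE.
rewrite [X in _ + X]mxE [X in - X]mxE mulmxA; congr (_ - _).
have -> : (y^T *m invmx A *m f) 0 0 = s.
  rewrite /s -[in RHS](trmxK (f^T *m invmx A *m y)) [RHS]mxE.
  by rewrite !trmx_mul trmxK trmx_inv Asym mulmxA.
by rewrite -/s; ring.
Qed.

End RankOne.

(** * Convex functions on the half-line *)

Section RayFunctions.
Context {R : realType}.
Implicit Types H : R -> R.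

(** The two difference quotients are the same function, so directional derivatives reduce to
    one-variable calculus. *)
Lemma is_derive_line (V : normedModType R) (f : V -> R^o) (a v : V) (d : R^o) :
  is_derive a v f d <-> is_derive (0 : R^o) 1 (fun h => f (a + h *: v)) d.
Proof.
have E : (fun h : R => h^-1 *: ((f \o shift a) (h *: v) - f a)) =
    (fun h : R => h^-1 *: (((fun h : R^o => f (a + h *: v)) \o shift 0) (h *: 1)
       - f (a + 0 *: v))).
  by apply/funext => h /=; rewrite scale0r addr0 addr0 /GRing.scale /= mulr1 (addrC a).
by split => -[dr dv]; split; move: dr dv; rewrite /derivable /derive E.
Qed.

(** Replaces the interval-typed weight of [convex_function] by a real number with explicit
    bounds. *)
Lemma convex_on_ray_le H : convex_on_ray H -> forall l s t : R,
  0 <= l -> l <= 1 -> 0 <= s -> 0 <= t ->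
  H (l * s + (1 - l) * t) <= l * H s + (1 - l) * H t.
Proof.
move=> Hc l s t l0 l1 s0 t0.
have l01 : Itv.spec (@Itv.num_sem R) (Itv.Real `[0%Z, 1%Z]) l.
  by rewrite /= /Itv.num_sem /= in_itv /= l0 l1 realE l0.
pose p := Itv.mk l01.
by have := Hc p s t; rewrite !inE /= !in_itv /= !andbT => /(_ s0 t0).
Qed.

(** The secant slopes [(H (z + h (t - z)) - H z) / h] are at most [H t - H z]; let [h] tend to 0. *)
Lemma convex_tangent_le H (z t : R) : convex_on_ray H -> 0 < z -> 0 <= t ->
  derivable (H : R^o -> R^o) z 1 -> H z + derive1 H z * (t - z) <= H t.
Proof.
move=> Hc z0 t0 dH.
have dHl : is_derive (0 : R^o) (1 : R^o) (fun h => (H : R^o -> R^o) (z + h *: (t - z)))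
    (derive1 H z * (t - z)).
  have dg : is_derive (0 : R^o) (1 : R^o) (fun h : R^o => z + h *: (t - z) : R^o) (t - z).
    exact: (@is_derive_line R^o id z (t - z) (t - z)).1.
  apply: (@is_derive1_comp _ H (fun h => z + h *: (t - z))).
  rewrite scale0r addr0; apply: DeriveDef => //.
  by rewrite derive1E.
rewrite -lerBrDl.
have [/cvg_ex[/= d dc] dv] := dHl.
rewrite -dv /derive (cvg_lim _ dc) //.
(* Convexity speaks only of [0 < h <= 1], hence the limit from the right. *)
apply: cvgr_to_le (cvg_dnbhs_at_right dc) _.
near=> h.
have h0 : 0 < h by near: h; exact: nbhs_right_gt.
have h1 : h <= 1 by near: h; exact: nbhs_right_le.
rewrite /= scale0r !addr0 /GRing.scale /= mulr1 mulrC ler_pdivrMr //.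
have := convex_on_ray_le Hc (ltW h0) h1 t0 (ltW z0).
rewrite (_ : h * t + _ = z + h * (t - z)); last by ring.
by move=> /lerB - /(_ _ _ (lexx (H z))) /le_trans; apply; lra.
Unshelve. all: by end_near. Qed.

(** Stands in for continuity of the derivative. In the convex case the tangent inequalities at [z k]
    pass to the limit, so [H t - L * t] is minimal at [zs] and its derivative vanishes there. The
    concave case follows by negating [H] and [L]. *)
Lemma convex_or_concave_deriv_limit H (z : nat -> R) (zs L : R) :
  convex_on_ray H \/ concave_on_ray H ->
  (forall t, 0 < t -> derivable (H : R^o -> R^o) t 1) ->
  (\forall k \near \oo, 0 < z k) -> 0 < zs -> z @ \oo --> zs ->
  (fun k => derive1 H (z k)) @ \oo --> L -> derive1 H zs = L.
Proof.
move=> Hcc dH z_gt0 zs0 zcvg Lcvg.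
wlog Hc : H L Hcc dH Lcvg / convex_on_ray H.
  move=> wl; case: (Hcc) => Hc; first exact: (wl H L).
  have dN t : 0 < t -> derive1 (fun t => - H t) t = - derive1 H t.
    by move=> t0; rewrite !derive1E deriveN //; exact: dH.
  apply: oppr_inj; rewrite -dN //; apply: wl => //.
  - by left.
  - by move=> t t0; apply: derivableN; exact: dH.
  - apply: cvg_trans (cvgN Lcvg); apply: near_eq_cvg; near=> k.
    by rewrite fctE dN //; near: k.
have Hcont : {for zs, continuous H}.
  by apply: differentiable_continuous; apply/derivable1_diffP; exact: dH.
have sub t : 0 <= t -> H zs + L * (t - zs) <= H t.
  move=> t0.
  have lim_tangent : (fun k => H (z k) + derive1 H (z k) * (t - z k)) @ \oo -->
      H zs + L * (t - zs).
    apply: cvgD; first exact: cvg_comp zcvg Hcont.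
    by apply: cvgM => //; apply: cvgB => //; exact: cvg_cst.
  apply: (cvgr_to_le lim_tangent).
  near=> k; have zk : 0 < z k by near: k.
  by apply: convex_tangent_le => //; exact: dH.
pose f t := H t - L * t.
have df t : 0 < t -> is_derive (t : R^o) (1 : R^o) (f : R^o -> R^o) (derive1 H t - L).
  move=> t0; have dHt : is_derive (t : R^o) (1 : R^o) (H : R^o -> R^o) (derive1 H t).
    by apply: DeriveDef; [exact: dH|rewrite derive1E].
  apply: (@is_deriveB _ _ _ (H : R^o -> R^o) (fun t : R^o => L * t : R^o)) => //.
  have := @is_deriveZ _ _ _ (@id R^o) L t 1 1 _.
  by rewrite /GRing.scale /= mulr1; apply.
have zs_in : zs \in `]0, zs + 1[%R by rewrite in_itv /= zs0 ltrDl ltr01.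
have [_ e0] : is_derive (zs : R^o) (1 : R^o) (f : R^o -> R^o) 0.
  apply: (@derive1_at_min R f 0 (zs + 1) zs) zs_in _.
  - by rewrite addr_ge0 // ltW.
  - by move=> t; rewrite in_itv /= => /andP[t0 _]; apply/ex_derive/df.
  - move=> t; rewrite in_itv /= => /andP[t0 _].
    by have := sub t (ltW t0); rewrite /f; lra.
have [_ e1] := df zs zs0.
by apply/eqP; rewrite -subr_eq0 -e1 e0.
Unshelve. all: by end_near. Qed.

End RayFunctions.

(** * The objective *)

(** The function of [h] is the objective along a coordinate line, as given by the rank-one formulas:
    [q] is [qtilde], [p] the square of [f_i^T S^-1 y], and [c], [D], [C] are the constant parts of
    the quadratic form, of [ln det] and of the penalty. *)
Lemma is_derive_rank1_profile {R : realType} (c p q D C z dH : R) (H : R -> R) :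
  is_derive z 1 H dH ->
  is_derive (0 : R) (1 : R) (fun h : R => 2^-1 * (c - h * p / (1 + h * q))
    + 2^-1 * (D + ln (1 + h * q)) + (C + H (z + h))) (2^-1 * (q - p) + dH).
Proof.
move=> dHz.
have d1 : is_derive (0 : R) (1 : R) (fun h : R => 1 + h * q) q.
  by apply: is_derive_eq; rewrite /GRing.scale /=; ring.
have dV : is_derive (0 : R) (1 : R) (fun h : R => (1 + h * q)^-1) (- q).
  apply: is_derive_eq; first by apply: is_deriveV; rewrite mul0r addr0 oner_neq0.
  by rewrite /= mul0r addr0 expr1n invr1 /GRing.scale /= mulN1r.
have ln1 : is_derive (1 + 0 * q) 1 (@ln R) 1.
  rewrite mul0r addr0; apply: is_derive_eq (is_derive1_ln ltr01) _.
  by rewrite invr1.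
have dl : is_derive (0 : R) (1 : R) (fun h : R => ln (1 + h * q)) q.
  by have := @is_derive1_comp _ (@ln R) (fun h => 1 + h * q) 0 _ _ ln1 d1; rewrite mul1r.
have dz : is_derive (0 : R) (1 : R) (fun h : R => z + h) 1.
  by apply: is_derive_eq; rewrite add0r mulr1.
have dH0 : is_derive (z + 0) 1 H dH by rewrite addr0.
have dh : is_derive (0 : R) (1 : R) (fun h : R => H (z + h)) dH.
  by have := @is_derive1_comp _ H (fun h => z + h) 0 _ _ dH0 dz; rewrite mulr1.
apply: is_derive_eq.
rewrite /GRing.scale /= !mul0r addr0 invr1; ring.
Qed.

Section Objective.
Context {R : realType} {m n : nat} (F : 'M[R]_(m, n)) (y : 'cV[R]_m).
Context (sigma : R) (H : R -> R).
Hypothesis sigma_gt0 : 0 < sigma.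
Hypothesis H_ge0 : forall t, 0 <= t -> 0 <= H t.

Local Notation S := (covS F sigma).
Local Notation J := (objJ F y sigma H).

(** By monotonicity all coordinates but the [i]-th may be set to zero, which leaves a rank-one
    update of [S 0]. This growth bounds the iterates. *)
Lemma ln_det_covS_ge (g : 'cV[R]_n) i : (forall i, 0 <= g i 0) ->
  ln (\det (S 0)) + ln (1 + g i 0 * qtilde F sigma 0 i) <= ln (\det (S g)).
Proof.
move=> g0; have z0 (j : 'I_n) : 0 <= (0 : 'cV[R]_n) j 0 by rewrite mxE.
have S0pos : posdef (S 0) by exact: covS_posdef.
have q0 := qtilde_ge0 F sigma_gt0 i z0.
rewrite -lnM ?posrE ?posdef_det_gt0 //; last first.
  by rewrite ltr_pwDl // mulr_ge0.
rewrite -det_rank1_update ?posdef_unit // -covS_shift add0r.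
apply: ln_det_covS_homo => // j; rewrite !mxE.
  by rewrite mulr_ge0 ?ler0n.
by rewrite eqxx andbT; have [->|_] := eqVneq j i; rewrite ?mulr1 ?mulr0.
Qed.

Lemma objJ_ge_ln_det (g : 'cV[R]_n) : (forall i, 0 <= g i 0) ->
  2^-1 * ln (\det (S g)) <= J g.
Proof.
move=> g0; have : 0 <= (y^T *m invmx (S g) *m y) 0 0.
  exact/posdef_quad_ge0/posdef_inv/covS_posdef.
have : 0 <= \sum_(i < n) H (g i 0) by apply: sumr_ge0 => j _; exact: H_ge0.
by rewrite /objJ; lra.
Qed.

(** For small [h] of either sign the rank-one formulas identify [J] on the coordinate line with the
    explicit profile [phi]. *)
Lemma objJ_is_derive (g : 'cV[R]_n) i : (forall j, 0 <= g j 0) -> 0 < g i 0 ->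
  derivable (H : R^o -> R^o) (g i 0) 1 ->
  is_derive g (delta_mx i 0) (J : _ -> R^o)
    (2^-1 * (qtilde F sigma g i - ((F^T *m (invmx (S g) *m y)) i 0) ^+ 2)
     + derive1 H (g i 0)).
Proof.
move=> g0 gi0 dH.
have Spos := covS_posdef F sigma_gt0 g0.
set q := qtilde F sigma g i; set a := (_ *m _) i 0.
have aE : ((col i F)^T *m invmx (S g) *m y) 0 0 = a.
  by rewrite -mulmxA trmulmx_col.
apply/is_derive_line.
pose phi (h : R) := 2^-1 * ((y^T *m invmx (S g) *m y) 0 0 - h * a ^+ 2 / (1 + h * q))
   + 2^-1 * (ln (\det (S g)) + ln (1 + h * q))
   + (\sum_(j < n | j != i) H (g j 0) + H (g i 0 + h)).
have q0 : 0 <= q by exact: qtilde_ge0.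
apply: (@near_eq_is_derive _ _ _ (phi : R^o -> R^o)).
  near=> h.
  have h0 : 0 < 1 + h * q.
    (* This bound forces [1 + h * q >= (1 + q)^-1 > 0], also when [q = 0]. *)
    have hlt : - (1 + q)^-1 < h.
      by near: h; apply: lt_nbhsr; rewrite oppr_lt0 invr_gt0 ltr_pwDl.
    have hq : - (1 + q)^-1 * q <= h * q by rewrite ler_wpM2r // ltW.
    have q1 : 0 < 1 + q by rewrite ltr_pwDl.
    apply: (@lt_le_trans _ _ (1 + - (1 + q)^-1 * q)); last by rewrite lerD2l.
    rewrite (_ : _ + _ = (1 + q)^-1) ?invr_gt0 //.
    by field; rewrite gt_eqF.
  rewrite /phi /objJ covS_shift; congr (_ + _ + _).
  - rewrite quad_inv_rank1_update ?posdef_unit ?covS_tr //; last by rewrite gt_eqF.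
    by rewrite aE.
  - rewrite det_rank1_update ?posdef_unit // lnM // posrE ?posdef_det_gt0 //.
  - rewrite [RHS](bigD1 i) //= addrC !mxE !eqxx /= mulr1; congr (_ + _).
    by apply: eq_bigr => j ji; rewrite !mxE (negPf ji) mulr0 addr0.
apply: is_derive_rank1_profile.
by apply: DeriveDef => //; rewrite derive1E.
Unshelve. all: by end_near. Qed.

End Objective.

(** * Limits of matrices *)

Section MatrixLimits.
Context {R : realType} {T : Type} (G : set_system T) {FG : Filter G}.

Lemma cvg_sumr I (r : seq I) (f : I -> T -> R) (l : I -> R) :
  (forall i, f i @ G --> l i) ->
  (fun k => \sum_(i <- r) f i k) @ G --> \sum_(i <- r) l i.
Proof.
move=> fl; elim: r => [|a r IH].
  by rewrite big_nil; under eq_fun do rewrite big_nil; exact: cvg_cst.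
by rewrite big_cons; under eq_fun do rewrite big_cons; exact: cvgD.
Qed.

Lemma cvg_prodr I (r : seq I) (f : I -> T -> R) (l : I -> R) :
  (forall i, f i @ G --> l i) ->
  (fun k => \prod_(i <- r) f i k) @ G --> \prod_(i <- r) l i.
Proof.
move=> fl; elim: r => [|a r IH].
  by rewrite big_nil; under eq_fun do rewrite big_nil; exact: cvg_cst.
by rewrite big_cons; under eq_fun do rewrite big_cons; exact: cvgM.
Qed.

Lemma cvg_mx m n (A : T -> 'M[R]_(m, n)) (L : 'M[R]_(m, n)) :
  (forall i j, (fun k => A k i j) @ G --> L i j) -> A @ G --> L.
Proof.
move=> AL U [B LB BU].
apply: (@filterS _ G _ (fun k => forall i j, B i j (A k i j))).
  by move=> k Bk; apply: BU.
apply: filter_forall => i; apply: filter_forall => j.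
exact: AL (LB i j).
Qed.

Lemma cvg_entry m n (A : T -> 'M[R]_(m, n)) (L : 'M[R]_(m, n)) i j :
  A @ G --> L -> (fun k => A k i j) @ G --> L i j.
Proof. by move=> AL; exact: (cvg_comp _ _ AL (@coord_continuous R m n i j L)). Qed.

Lemma cvg_mulmx m n p (A : T -> 'M[R]_(m, n)) (B : T -> 'M[R]_(n, p))
    (LA : 'M[R]_(m, n)) (LB : 'M[R]_(n, p)) :
  A @ G --> LA -> B @ G --> LB -> (fun k => A k *m B k) @ G --> LA *m LB.
Proof.
move=> AL BL; apply: cvg_mx => i j; rewrite mxE.
under eq_fun do rewrite mxE.
by apply: cvg_sumr => l; apply: cvgM; exact: cvg_entry.
Qed.

Lemma cvg_det m (A : T -> 'M[R]_m) (L : 'M[R]_m) :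
  A @ G --> L -> (fun k => \det (A k)) @ G --> \det L.
Proof.
move=> AL; apply: cvg_sumr => s.
apply: cvgM; first exact: cvg_cst.
by apply: cvg_prodr => i; exact: cvg_entry.
Qed.

(** By the cofactor formula, entries of the inverse are quotients of determinants. Invertibility of
    each [A k] excludes the default branch of [invmx]. *)
Lemma cvg_invmx m (A : T -> 'M[R]_m) (L : 'M[R]_m) : L \in unitmx ->
  (forall k, A k \in unitmx) ->
  A @ G --> L -> (fun k => invmx (A k)) @ G --> invmx L.
Proof.
move=> Lu Au AL; apply: cvg_mx => i j.
rewrite /invmx Lu mxE; under eq_fun do rewrite Au mxE.
apply: cvgM; first by apply: cvgV; [rewrite -unitfE -unitmxE|exact: cvg_det].
rewrite mxE; under eq_fun do rewrite mxE.
apply: cvgM; first exact: cvg_cst.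
apply: cvg_det; apply: cvg_mx => k l; rewrite !mxE.
by under eq_fun do rewrite !mxE; exact: cvg_entry.
Qed.

End MatrixLimits.
Arguments cvg_entry {R T G m n A L} i j _.

(** * One proximal step *)

Section ProximalStep.
Context {R : realType} {m n : nat} (F : 'M[R]_(m, n)) (y : 'cV[R]_m).
Context (sigma tau : R) (H : R -> R).
Hypothesis sigma_gt0 : 0 < sigma.
Hypothesis H_derivable : forall t, 0 < t -> derivable (H : R^o -> R^o) t 1.
Hypothesis H_cvx : convex_on_ray H \/ concave_on_ray H.

Local Notation S := (covS F sigma).
Local Notation J := (objJ F y sigma H).

(** An equality if [H] is convex; otherwise [H] is concave and lies below its tangent at [g i 0]. *)
Lemma ell_majorizes (g : 'cV[R]_n) i t : 0 < g i 0 -> 0 <= t ->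
  2^-1 * (qtilde F sigma g i * (t - g i 0)) + (H t - H (g i 0)) <=
  ell F sigma H g i t - ell F sigma H g i (g i 0).
Proof.
move=> gi0 t0; rewrite /ell; case: asboolP => Hc; first by lra.
have Hv : concave_on_ray H by case: H_cvx.
have dN : derivable ((fun t => - H t) : R^o -> R^o) (g i 0) 1.
  by apply: derivableN; exact: H_derivable.
have := convex_tangent_le Hv gi0 t0 dN.
rewrite derive1E deriveN; last exact: H_derivable.
by rewrite -derive1E; lra.
Qed.

(** The bounds on the quadratic form, on [ln det] and on [H] add up, coordinate by coordinate, to
    differences of [prox_obj], whose proximal term vanishes at the old point. *)
Lemma objJ_descent (g g' x : 'cV[R]_n) :
  (forall i, 0 <= g i 0) -> (forall i, 0 <= g' i 0) ->
  (forall i, g i 0 = 0 -> g' i 0 = 0) -> (forall i, g i 0 != 0 -> g' i 0 != 0) ->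
  x = diag_mx g^T *m F^T *m invmx (S g) *m y ->
  (forall i, g i 0 != 0 ->
    prox_obj F sigma H tau x g i (g' i 0) <= prox_obj F sigma H tau x g i (g i 0)) ->
  J g' + tau / 2 * \sum_i (g' i 0 - g i 0) ^+ 2 <= J g.
Proof.
move=> g0 g'0 gz gnz xE prox_le.
have quad_le := quad_inv_covS_le sigma_gt0 g0 g'0 gz gnz xE.
have det_le := ln_det_covS_le F sigma_gt0 g0 g'0.
suff : 2^-1 * \sum_i (x i 0 ^+ 2 / g' i 0 - x i 0 ^+ 2 / g i 0)
    + 2^-1 * \sum_i qtilde F sigma g i * (g' i 0 - g i 0)
    + (\sum_i H (g' i 0) - \sum_i H (g i 0))
    + tau / 2 * \sum_i (g' i 0 - g i 0) ^+ 2 <= 0.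
  by rewrite /objJ; move: quad_le det_le; lra.
rewrite -sumrB !mulr_sumr -!big_split /=; apply: sumr_le0 => i _.
have [gi0|gi0] := eqVneq (g i 0) 0.
  by rewrite gz // gi0 !subrr expr0n /= !mulr0 !addr0.
have gi_gt0 : 0 < g i 0 by rewrite lt_neqAle eq_sym gi0 g0.
have := ell_majorizes gi_gt0 (g'0 i); have := prox_le i gi0.
rewrite /prox_obj subrr expr0n /= mulr0 addr0 !invfM.
by move: (_ ^+ 2) (_ ^-1) => *; lra.
Qed.

(** Fermat's rule at the interior minimizer [z]. The slope of [H] is taken at the new point if [H]
    is kept, at the old one if it is linearized. *)
Lemma prox_stationary (x g : 'cV[R]_n) i z : 0 < g i 0 ->
  is_argmin_pos (prox_obj F sigma H tau x g i) z ->
  derive1 H (if `[< convex_on_ray H >] then z else g i 0) =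
    x i 0 ^+ 2 / (2 * z ^+ 2) - 2^-1 * qtilde F sigma g i - tau * (z - g i 0).
Proof.
move=> gi0 [z0 zmin].
pose w t := if `[< convex_on_ray H >] then t else g i 0.
have dprox (t : R) : 0 < t -> is_derive t 1 (prox_obj F sigma H tau x g i)
    (- (x i 0 ^+ 2 / (2 * t ^+ 2)) + (2^-1 * qtilde F sigma g i + derive1 H (w t))
     + tau * (t - g i 0)).
  move=> t0.
  have dH : is_derive t 1 H (derive1 H t).
    by apply: DeriveDef; [exact: H_derivable|rewrite derive1E].
  have dV : is_derive t 1 (fun t : R => (2 * t)^-1) (- (2 * t ^+ 2)^-1).
    have d2 : is_derive t 1 (fun t : R => 2 * t) 2.
      by apply: is_derive_eq; rewrite /GRing.scale /=; ring.
    apply: is_derive_eq; first by apply: is_deriveV; rewrite mulf_neq0 // gt_eqF.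
    by rewrite /GRing.scale /=; field; rewrite gt_eqF.
  have dell : is_derive t 1 (ell F sigma H g i)
      (2^-1 * qtilde F sigma g i + derive1 H (w t)).
    rewrite /w /ell; case: asboolP => _.
      by apply: is_derive_eq; rewrite /GRing.scale /=; ring.
    by apply: is_derive_eq; rewrite /GRing.scale /=; ring.
  rewrite /prox_obj; apply: is_derive_eq; rewrite /GRing.scale /=.
  by field; rewrite gt_eqF.
have [_ e0] : is_derive (z : R) 1 (prox_obj F sigma H tau x g i) 0.
  apply: (@derive1_at_min R _ 0 (z + 1) z).
  - by rewrite addr_ge0 // ltW.
  - by move=> t; rewrite in_itv /= => /andP[t0 _]; apply/ex_derive/dprox.
  - by rewrite in_itv /= z0 ltrDl ltr01.
  - by move=> t; rewrite in_itv /= => /andP[t0 _]; exact: zmin.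
have [_ e1] := dprox z z0.
by move: e1; rewrite e0 -/(w z); lra.
Qed.

End ProximalStep.

(** * Subsequences and compactness for column vectors *)

Lemma cvg_subseq (s : nat -> nat) : {homo s : a b / (a < b)%N} -> s @ \oo --> \oo.
Proof.
move=> s_incr A [N _ NA]; exists N => // k /= Nk; apply: NA => /=.
apply: leq_trans Nk _; elim: k => // k IH.
exact: leq_ltn_trans IH (s_incr _ _ (ltnSn k)).
Qed.

(** Successive extraction: after [d] rounds the first [d] coordinates converge, and further
    extraction preserves this. *)
Lemma bolzano_weierstrass_cV (R : realType) n (u : nat -> 'cV[R]_n) (b : 'I_n -> R) :
  (forall k i, `|u k i 0| <= b i) ->
  exists2 s : nat -> nat, {homo s : a b / (a < b)%N} & cvg ((fun k => u (s k)) @ \oo).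
Proof.
move=> ub.
suff sub d : (d <= n)%N -> exists2 s : nat -> nat, {homo s : a b / (a < b)%N} &
    forall i : 'I_n, (i < d)%N -> cvg ((fun k => u (s k) i 0) @ \oo).
  have [s s_incr scvg] := sub n (leqnn n); exists s => //; apply/cvg_ex.
  exists (\col_i lim ((fun k => u (s k) i 0) @ \oo)).
  apply: cvg_mx => i j; rewrite (ord1 j) mxE.
  by have /cvg_ex[l ul] := scvg i (ltn_ord i); rewrite (cvg_lim _ ul).
elim: d => [_|d IH dn]; first by exists id.
have [s s_incr scvg] := IH (ltnW dn).
pose i0 := Ordinal dn.
have [|f f_mono fcvg] := @bolzano_weierstrass R (fun k => u (s k) i0 0).
  exists (b i0); split; first exact: num_real.
  by move=> t bt k _ /=; apply: le_trans (ub _ _) (ltW bt).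
have f_incr : {homo f : a b / (a < b)%N}.
  by move=> p q; rewrite -(leqW_mono f_mono).
exists (s \o f) => [p q pq|i]; first exact/s_incr/f_incr.
rewrite ltnS leq_eqVlt => /orP[/eqP id|/scvg/cvg_ex[l ul]].
  by rewrite (_ : i = i0) //; exact: val_inj.
by apply/cvg_ex; exists l; apply: cvg_comp ul; exact: cvg_subseq.
Qed.

Lemma cvg_diag_tr (R : realType) n (u : nat -> 'cV[R]_n) (g : 'cV[R]_n) :
  u @ \oo --> g -> (fun k => diag_mx (u k)^T) @ \oo --> diag_mx g^T.
Proof.
move=> ug; apply: cvg_mx => i j; rewrite !mxE; under eq_fun do rewrite !mxE.
case: (i == j); rewrite ?mulr1n ?mulr0n; last exact: cvg_cst.
exact: cvg_entry.
Qed.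

(** * Convergence of the iterates *)

Section PalmSequence.
Context {R : realType} {m n : nat} (F : 'M[R]_(m, n)) (y : 'cV[R]_m).
Context (sigma tau omega : R) (H : R -> R) (x gamma : nat -> 'cV[R]_n).
Hypothesis F_neq0 : forall j, col j F <> 0.
Hypothesis sigma_gt0 : 0 < sigma.
Hypothesis tau_gt0 : 0 < tau.
Hypothesis H_derivable : forall t, 0 < t -> derivable (H : R^o -> R^o) t 1.
Hypothesis H_ge0 : forall t, 0 <= t -> 0 <= H t.
Hypothesis H_cvx : convex_on_ray H \/ concave_on_ray H.
Hypothesis gamma0_gt0 : forall i, 0 < gamma 0%N i 0.
Hypothesis palm : palm_sequence F y sigma H tau omega x gamma.

Local Notation S := (covS F sigma).
Local Notation J := (objJ F y sigma H).

Lemma palm_gamma_ge0 k i : 0 <= gamma k i 0.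
Proof.
elim: k i => [|k IH] i; first exact: ltW.
have [/(palm_gamma_zero palm) -> //|/eqP] := eqVneq (gamma k i 0) 0.
move=> /(palm_gamma_update palm)[g [g0 _] ->].
by case: ifP => // _; exact: ltW.
Qed.

(** A nonzero new entry was not thresholded, so it is the minimizer itself. *)
Lemma palm_argmin k i : gamma k i 0 != 0 -> gamma k.+1 i 0 != 0 ->
  is_argmin_pos (prox_obj F sigma H tau (x k.+1) (gamma k) i) (gamma k.+1 i 0).
Proof.
move=> /eqP /(palm_gamma_update palm)[g gmin ->].
by case: ifP => //; rewrite eqxx.
Qed.

(** Each nonzero old entry is positive, hence a competitor in its own subproblem. *)
Lemma palm_descent k : no_entry_thresholded gamma k ->
  J (gamma k.+1) + tau / 2 * \sum_i (gamma k.+1 i 0 - gamma k i 0) ^+ 2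
    <= J (gamma k).
Proof.
move=> nt; have nz i : gamma k i 0 != 0 -> gamma k.+1 i 0 != 0.
  by move=> /eqP/nt/eqP.
apply: (@objJ_descent _ _ _ _ _ _ _ _ _ _ _ _ _ (x k.+1)) => //.
- exact: palm_gamma_ge0.
- exact: palm_gamma_ge0.
- by move=> i; exact: (palm_gamma_zero palm).
- exact: (palm_x_update palm).
- move=> i gi0; have [_ gmin] := palm_argmin gi0 (nz i gi0); apply: gmin.
  by rewrite lt_neqAle eq_sym gi0 palm_gamma_ge0.
Qed.

(** A zero gain would give [gamma k.+1 = gamma k], hence [x k.+2 = x k.+1], against
    [palm_running]. *)
Lemma palm_decrease k : no_entry_thresholded gamma k ->
  J (gamma k.+1) < J (gamma k).
Proof.
move=> nt; apply: lt_le_trans (palm_descent nt); rewrite ltrDl.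
rewrite mulr_gt0 ?divr_gt0 // lt_neqAle eq_sym.
rewrite sumr_ge0 ?andbT => [|i _]; last exact: sqr_ge0.
apply/eqP => /psumr_eq0P eq0; apply: (palm_running palm (k := k)).
rewrite !(palm_x_update palm) (_ : gamma k.+1 = gamma k) //.
apply/matrixP => i j; rewrite (ord1 j); apply/eqP; rewrite -subr_eq0 -sqrf_eq0.
by apply/eqP/eq0 => // l _; exact: sqr_ge0.
Qed.

(** Once an entry is zero the condition on it is vacuous; an entry that is never zero satisfies it
    always. The maximum over the entries serves all. *)
Lemma palm_eventually_unthresholded :
  exists K, forall k, (K <= k)%N -> no_entry_thresholded gamma k.
Proof.
have /fin_all_exists[K KP] (i : 'I_n) : exists K, forall k, (K <= k)%N ->
    gamma k i 0 <> 0 -> gamma k.+1 i 0 <> 0.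
  have [[K gK]|nz] := pselect (exists K, gamma K i 0 = 0).
    exists K => k /subnK <-; elim: (k - K)%N => [|d IH] //=.
    suff g0 e : gamma (e + K)%N i 0 = 0 by rewrite g0.
    by elim: e => [//|e IHe]; rewrite addSn; exact: (palm_gamma_zero palm).
  by exists 0%N => k _ _ g0; apply: nz; exists k.+1.
exists (\max_i K i) => k Kk i; apply: KP; apply: leq_trans Kk.
exact: leq_bigmax.
Qed.

(** Monotone from [K] on, and bounded below through [ln det] at [gamma = 0]. *)
Lemma palm_objJ_cvg : cvg ((fun k => J (gamma k)) @ \oo).
Proof.
have [K KP] := palm_eventually_unthresholded.
pose b := 2^-1 * ln (\det (S 0)).
apply: (@near_nonincreasing_is_cvgn _ _ b).
  near=> p => q pq.
  have Kp : (K <= p)%N by near: p; exact: nbhs_infty_ge.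
  elim: q pq => [|q IH]; first by rewrite leqn0 => /eqP ->.
  rewrite leq_eqVlt => /orP[/eqP -> //|]; rewrite ltnS => pq.
  apply: le_trans (IH pq); apply/ltW/palm_decrease/KP.
  exact: leq_trans Kp pq.
near=> k. apply: le_trans _ (objJ_ge_ln_det F y sigma_gt0 H_ge0 (palm_gamma_ge0 k)).
rewrite ler_pM2l ?invr_gt0 //; apply: ln_det_covS_homo => // i; rewrite mxE //.
exact: palm_gamma_ge0.
Unshelve. all: by end_near. Qed.

(** Past [K] the objective stays below [J (gamma K)], which bounds [ln det S] and so each factor
    [1 + gamma_i q_i]; nonzero columns make [q_i] positive. *)
Lemma palm_gamma_bounded : exists K (b : 'I_n -> R), forall k i,
  (K <= k)%N -> `|gamma k i 0| <= b i.
Proof.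
have [K KP] := palm_eventually_unthresholded.
pose d := ln (\det (S 0)); pose q i := qtilde F sigma 0 i.
(* Solves [d + ln (1 + gamma_i q_i) <= 2 J (gamma K)] for [gamma_i], dropping the 1. *)
exists K, (fun i => expR (2 * J (gamma K) - d) / q i) => k i Kk.
have JK : J (gamma k) <= J (gamma K).
  rewrite -(subnKC Kk); elim: (k - K)%N => [|e IH]; first by rewrite addn0.
  rewrite addnS; apply: le_trans IH; apply/ltW/palm_decrease/KP.
  exact: leq_addr.
have z0 (j : 'I_n) : 0 <= (0 : 'cV[R]_n) j 0 by rewrite mxE.
have qi0 : 0 < q i.
  have [_] := posdef_inv (covS_posdef F sigma_gt0 z0); apply.
  exact/eqP/F_neq0.
have gk0 := palm_gamma_ge0 k.
rewrite ger0_norm // ler_pdivlMr //.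
have := ln_det_covS_ge F sigma_gt0 i gk0; rewrite -/d -/(q i).
have := objJ_ge_ln_det F y sigma_gt0 H_ge0 gk0.
have gq : 0 <= gamma k i 0 * q i by rewrite mulr_ge0 // ltW.
move=> Jge ln_ge; apply: (@le_trans _ _ (1 + gamma k i 0 * q i)).
  by rewrite lerDr.
by rewrite -ler_ln ?posrE ?expR_gt0 ?ltr_pwDl // expRK; lra.
Qed.

(** The descent inequality bounds the squared step by [2 / tau] times the drop of [J], which tends
    to 0. *)
Lemma palm_step_cvg0 i : (fun k => gamma k.+1 i 0 - gamma k i 0) @ \oo --> 0.
Proof.
have [K KP] := palm_eventually_unthresholded.
have /cvg_ex[l Jl] := palm_objJ_cvg.
have dJ : (fun k => 2 / tau * (J (gamma k) - J (gamma k.+1))) @ \oo --> 0.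
  suff : (fun k => 2 / tau * (J (gamma k) - J (gamma k.+1))) @ \oo -->
      2 / tau * (l - l) by rewrite subrr mulr0.
  apply: cvgM; first exact: cvg_cst.
  by apply: cvgB => //; rewrite (cvg_shiftS (fun k => J (gamma k))).
have sq0 : (fun k => (gamma k.+1 i 0 - gamma k i 0) ^+ 2) @ \oo --> 0.
  apply: (squeeze_cvgr _ (cvg_cst 0) dJ); near=> k.
  have Kk : (K <= k)%N by near: k; exact: nbhs_infty_ge.
  rewrite sqr_ge0 /=; have := palm_descent (KP k Kk).
  rewrite (bigD1 i) //=; set s := \sum_(_ | _) _.
  have s0 : 0 <= s by apply: sumr_ge0 => j _; exact: sqr_ge0.
  set e := _ ^+ 2 => le_J; rewrite mulrAC ler_pdivlMr //.
  have : 0 <= tau * s by rewrite mulr_ge0 // ltW.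
  by move: le_J; lra.
apply/cvgrPdist_lt => e e0; near=> k.
rewrite sub0r normrN -(ltr_pXn2r (n := 2)) ?nnegrE ?(ltW e0) //.
rewrite -normrX -normrN -sub0r; near: k.
by apply: (cvgrPdist_lt _ _).1 sq0 _ _; rewrite exprn_gt0.
Unshelve. all: by end_near. Qed.

Lemma covS_cvg (u : nat -> 'cV[R]_n) (g : 'cV[R]_n) :
  u @ \oo --> g -> (fun k => S (u k)) @ \oo --> S g.
Proof.
move=> ug; apply: cvgD; first exact: cvg_cst.
apply: cvg_mulmx; last exact: cvg_cst.
apply: cvg_mulmx; first exact: cvg_cst.
exact: cvg_diag_tr.
Qed.

(** * Limit points of the iterates *)

Section LimitPoint.
Variables (t : nat -> nat) (gs : 'cV[R]_n).
Hypothesis t_incr : {homo t : a b / (a < b)%N}.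
Hypothesis gamma_cvg : (fun k => gamma (t k)) @ \oo --> gs.

Let xs := diag_mx gs^T *m F^T *m invmx (S gs) *m y.

Lemma palm_limit_ge0 i : 0 <= gs i 0.
Proof.
have gcvg : (fun k => gamma (t k) i 0) @ \oo --> (gs i 0 : R).
  exact: cvg_entry.
apply: (cvgr_to_ge gcvg); near=> k.
exact: palm_gamma_ge0.
Unshelve. all: by end_near. Qed.

(** Needed because each stationarity equation involves two consecutive iterates. *)
Lemma palm_limit_next : (fun k => gamma (t k).+1) @ \oo --> gs.
Proof.
apply: cvg_mx => i j; rewrite (ord1 j).
have step0 : (fun k => gamma (t k).+1 i 0 - gamma (t k) i 0) @ \oo --> 0.
  exact: (cvg_comp _ _ (cvg_subseq t_incr) (palm_step_cvg0 i)).
rewrite -(add0r (gs i 0)).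
rewrite [X in X @ _](_ : _ =
    (fun k => gamma (t k).+1 i 0 - gamma (t k) i 0 + gamma (t k) i 0)); last first.
  by apply/funext => k; rewrite subrK.
by apply: cvgD => //; exact: cvg_entry.
Qed.

Lemma palm_limit_invmx : (fun k => invmx (S (gamma (t k)))) @ \oo --> invmx (S gs).
Proof.
apply: cvg_invmx (covS_cvg gamma_cvg) => [|k]; apply/posdef_unit/covS_posdef => //.
  exact: palm_limit_ge0.
exact: palm_gamma_ge0.
Qed.

Lemma palm_limit_x : (fun k => x (t k).+1) @ \oo --> xs.
Proof.
under eq_fun do rewrite (palm_x_update palm).
apply: cvg_mulmx; last exact: cvg_cst.
apply: cvg_mulmx; last exact: palm_limit_invmx.
apply: cvg_mulmx; last exact: cvg_cst.
exact: cvg_diag_tr.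
Qed.

Lemma palm_limit_KKT : is_KKT J gs.
Proof.
split=> [|i]; first exact: palm_limit_ge0.
have [->|gs_neq0] := eqVneq (gs i 0) 0; [by left|right].
have gs_gt0 : 0 < gs i 0 by rewrite lt_neqAle eq_sym gs_neq0 palm_limit_ge0.
have gcvg := cvg_entry i 0 gamma_cvg; have gcvg' := cvg_entry i 0 palm_limit_next.
have g_gt0 : \forall k \near \oo, 0 < gamma (t k) i 0 by exact: cvgr_gt gcvg _ gs_gt0.
have g_gt0' : \forall k \near \oo, 0 < gamma (t k).+1 i 0.
  exact: cvgr_gt gcvg' _ gs_gt0.
(* The point where the [k]-th stationarity equation evaluates the derivative of [H]. *)
pose z k := if `[< convex_on_ray H >] then gamma (t k).+1 i 0 else gamma (t k) i 0.
have zcvg : z @ \oo --> gs i 0 by rewrite /z; case: asboolP.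
have z_gt0 : \forall k \near \oo, 0 < z k by rewrite /z; case: asboolP.
have qcvg : (fun k => qtilde F sigma (gamma (t k)) i) @ \oo --> qtilde F sigma gs i.
  rewrite /qtilde; apply: cvg_entry.
  apply: cvg_mulmx; last exact: cvg_cst.
  by apply: cvg_mulmx; [exact: cvg_cst|exact: palm_limit_invmx].
have dHcvg : (fun k => derive1 H (z k)) @ \oo -->
    xs i 0 ^+ 2 / (2 * gs i 0 ^+ 2) - 2^-1 * qtilde F sigma gs i
      - tau * (gs i 0 - gs i 0).
  have : (fun k => x (t k).+1 i 0 ^+ 2 / (2 * gamma (t k).+1 i 0 ^+ 2)
      - 2^-1 * qtilde F sigma (gamma (t k)) i
      - tau * (gamma (t k).+1 i 0 - gamma (t k) i 0)) @ \oo -->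
    xs i 0 ^+ 2 / (2 * gs i 0 ^+ 2) - 2^-1 * qtilde F sigma gs i
      - tau * (gs i 0 - gs i 0).
    apply: cvgB; last by apply: cvgM; [exact: cvg_cst|exact: cvgB].
    apply: cvgB; last by apply: cvgM; [exact: cvg_cst|].
    apply: cvgM; first by apply: cvgM; exact: cvg_entry palm_limit_x.
    apply: cvgV; first by rewrite mulf_neq0 // sqrf_eq0.
    by apply: cvgM; [exact: cvg_cst|apply: cvgM].
  apply: cvg_trans; apply: near_eq_cvg; near=> k.
  have gk0 : 0 < gamma (t k) i 0 by near: k.
  have gk0' : 0 < gamma (t k).+1 i 0 by near: k.
  apply/esym; apply: prox_stationary => //.
  by apply: palm_argmin; rewrite gt_eqF.
have := convex_or_concave_deriv_limit H_cvx H_derivable z_gt0 gs_gt0 zcvg dHcvg.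
have := objJ_is_derive F y sigma_gt0 palm_limit_ge0 gs_gt0 (H_derivable gs_gt0).
(* The proximal term vanishes, and [xs i 0] is [gs i 0] times the [i]-th entry of [F^T S(gs)^-1 y],
   so the derivative of [J] cancels. *)
move=> dJ dHE; apply: is_derive_eq dJ _; rewrite dHE /xs -!mulmxA mul_diag_mx !mxE.
by rewrite subrr mulr0; field.
Unshelve. all: by end_near. Qed.

End LimitPoint.

End PalmSequence.

Unset Implicit Arguments.
Set Strict Implicit.

Theorem theorem4p2 (R : realType) (m n : nat) (hmn : (m <= n)%N)
    (F : 'M[R]_(m, n)) (hF : forall j, col j F <> 0)
    (y : 'cV[R]_m) (sigma : R) (hsigma : 0 < sigma)
    (H : R -> R)
    (Hcont : {within `[0, +oo[%classic, continuous H})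
    (Hdiff : forall t, 0 < t -> derivable (H : R^o -> R^o) t 1)
    (tau : R) (htau : 0 < tau)
    (Hnneg : forall t, 0 <= t -> 0 <= H t)
    (Hcvx : convex_on_ray H \/ concave_on_ray H)
    (omega : R) (x gamma : nat -> 'cV[R]_n)
    (hgamma0 : forall i, 0 < gamma 0%N i 0)
    (hpalm : palm_sequence F y sigma H tau omega x gamma) :
  let J := objJ F y sigma H in
  ((forall k, no_entry_thresholded gamma k -> J (gamma k.+1) < J (gamma k)) /\
   cvg ((fun k => J (gamma k)) @ \oo)) /\
  (exists s : nat -> nat, {homo s : a b / (a < b)%N} /\
   exists xstar gammastar : 'cV[R]_n,
     [/\ (fun k => x (s k)) @ \oo --> xstar,
         (fun k => gamma (s k)) @ \oo --> gammastar &
         is_KKT J gammastar]).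
Proof.
split; first split.
- by move=> k; exact: palm_decrease hpalm _.
- exact: palm_objJ_cvg hpalm.
have [K [b gb]] := palm_gamma_bounded hF hsigma htau Hdiff Hnneg Hcvx hgamma0 hpalm.
(* The bound holds only from [K] on, so the sequence is shifted by [K]. *)
have [|s s_incr /cvg_ex[/= gs gcvg]] :=
    @bolzano_weierstrass_cV R n (fun k => gamma (k + K)%N) b.
  by move=> k i; apply: gb; exact: leq_addl.
pose t k := (s k + K)%N.
have t_incr : {homo t : p q / (p < q)%N} by move=> p q /s_incr; rewrite ltn_add2r.
have tcvg : (fun k => gamma (t k)) @ \oo --> gs by exact: gcvg.
(* With [S] the successor: [x (t k).+1] is computed from [gamma (t k)], and [gamma (t k).+1] has the
   same limit as [gamma (t k)]. *)
exists (S \o t); split; first by move=> p q /t_incr.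
exists (diag_mx gs^T *m F^T *m invmx (covS F sigma gs) *m y), gs; split.
- exact: (palm_limit_x hsigma hgamma0 hpalm tcvg).
- exact: (palm_limit_next hsigma htau Hdiff Hnneg Hcvx hgamma0 hpalm t_incr tcvg).
- exact: (palm_limit_KKT hsigma htau Hdiff Hnneg Hcvx hgamma0 hpalm t_incr tcvg).
Qed.
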